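(* Let $n\in\mathbb{R}_+^I$, let $(u_c)_{c\in\mathbb{N}}$ be any uniformly bounded sequence in $\mathbb{R}^I$ with $cn+u_c\in\mathbb{Z}_+^I$, and let $\Lambda^*(n)$ and $\mathcal{J}^\circ$ be as in the context. Then $$E\,M^\circ(cn+u_c)\xrightarrow[c\to\infty]{}E\,M^\circ_{\Lambda^*(n)}$$ (componentwise, for all $j\in\mathcal{J}^\circ$, $i\in\mathcal{I}$ with $j\in i$).
   Context: Closed multiclass queueing network: $\mathcal{J}$ finite set of queues, $\mathcal{I}$ finite set of routes ($I=|\mathcal{I}|$), each route a subset of $\mathcal{J}$ with a cyclic visiting order (each queue at most once), rates $\mu_{ji}>0$ for $j\in i$. States $m=(m_{ji}: j\in i)$ with nonnegative integer entries, $m_j=\sum_{i: j\in i}m_{ji}$; for $n\in\mathbb{Z}_+^I$, $\mathcal{S}(n)=\{m:\sum_{j\in i}m_{ji}=n_i\ \forall i\}$, and the stationary distribution is $\pi(m\mid n)=B(n)^{-1}\prod_{j}\big(\frac{m_j!}{\prod_{i: j\in i}m_{ji}!}\prod_{i: j\in i}\mu_{ji}^{-m_{ji}}\big)$, $B(n)$ the normalizing constant. For $n\in\mathbb{R}_+^I$, $\Lambda^*(n)$ is the unique optimizer of: maximize $\sum_i n_i\log\Lambda_i$ s.t. $\sum_{i: j\in i}\Lambda_i/\mu_{ji}\le1$ for all $j\in\mathcal{J}$, $\Lambda\ge0$; $\mathcal{J}^\circ=\{j:\sum_{i: j\in i}\Lambda^*_i(n)/\mu_{ji}<1\}$. $M^\circ(n)$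 is the random vector $(M^\circ_{ji}: j\in\mathcal{J}^\circ, j\in i)$ of the numbers of route-$i$ customers at non-bottleneck queues $j$ under the stationary distribution $\pi(\cdot\mid n)$. $M^\circ_\Lambda$ is a random vector with distribution $\pi^\circ_\Lambda(m^\circ)=\prod_{j\in\mathcal{J}^\circ}\big(1-\sum_{i: j\in i}\frac{\Lambda_i}{\mu_{ji}}\big)\frac{m^\circ_j!}{\prod_{i: j\in i}m^\circ_{ji}!}\prod_{i: j\in i}(\Lambda_i/\mu_{ji})^{m^\circ_{ji}}$. *)

(* Defs.v *)
From HB Require Import structures.
From mathcomp Require Import all_boot all_order all_algebra.
From mathcomp Require Import all_classical all_reals all_analysis.
Set Implicit Arguments. Unset Strict Implicit. Unset Printing Implicit Defensive.
Import Order.TTheory GRing.Theory Num.Theory.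
Local Open Scope classical_set_scope.
Local Open Scope ring_scope.

Section Network.
Variables (R : realType) (J I : finType).
(* [route i j] means queue j belongs to route i (j \in i). *)
Variable route : I -> J -> bool.
Variable mu : J -> I -> R.

Definition mq (m : J -> I -> nat) (j : J) : nat := \sum_(i | route i j) m j i.

Definition weight (m : J -> I -> nat) : R :=
  \prod_(j : J) ((mq m j)`!%:R / \prod_(i | route i j) (m j i)`!%:R
                 * \prod_(i | route i j) (mu j i) ^- (m j i)).

(* Finite encoding of S(N): every state in S(N) has entries <= N_i <= sumN N. *)
Definition sumN (N : I -> nat) : nat := \sum_i N i.

Definition enc_state (N : I -> nat) :=
  {ffun J -> {ffun I -> 'I_(sumN N).+1}}.

Definition to_fun (N : I -> nat) (m : enc_state N) : J -> I -> nat :=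
  fun j i => nat_of_ord (m j i).

Definition in_S (N : I -> nat) (m : enc_state N) : bool :=
  [forall j, forall i, route i j || (to_fun m j i == 0%N)] &&
  [forall i, (\sum_(j | route i j) to_fun m j i == N i)%N].

Definition Bconst (N : I -> nat) : R :=
  \sum_(m : enc_state N | in_S m) weight (to_fun m).

Definition EM_net (N : I -> nat) (j : J) (i : I) : R :=
  (\sum_(m : enc_state N | in_S m) (to_fun m j i)%:R * weight (to_fun m))
  / Bconst N.

Definition feasible (L : I -> R) : Prop :=
  (forall i, 0 <= L i) /\
  (forall j, \sum_(i | route i j) L i / mu j i <= 1).

Definition objective (n : I -> R) (L : I -> R) : R := \sum_i n i * ln (L i).

(* Feasible points with finite objective (L_i > 0 whenever n_i > 0); points
   with L_i = 0 and n_i > 0 have objective -oo and are never optimal. *)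
Definition admissible (n : I -> R) (L : I -> R) : Prop :=
  feasible L /\ (forall i, 0 < n i -> 0 < L i).

Definition is_optimizer (n : I -> R) (L : I -> R) : Prop :=
  admissible n L /\
  (forall L', admissible n L' -> objective n L' <= objective n L).

Definition nonbottleneck (L : I -> R) (j : J) : bool :=
  \sum_(i | route i j) L i / mu j i < 1.

(* State space of M°_Lambda: entries indexed by j \in J°, j \in i *)
Definition S0 (L : I -> R) : set (J -> I -> nat) :=
  [set m | forall j i, ~~ (nonbottleneck L j && route i j) -> m j i = 0%N].

Definition pi0 (L : I -> R) (m : J -> I -> nat) : R :=
  \prod_(j | nonbottleneck L j)
    ((1 - \sum_(i | route i j) L i / mu j i)
     * ((mq m j)`!%:R / \prod_(i | route i j) (m j i)`!%:R)
     * \prod_(i | route i j) (L i / mu j i) ^+ (m j i)).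

Definition EM_lim (L : I -> R) (j : J) (i : I) : \bar R :=
  (\esum_(m in S0 L) ((m j i)%:R * pi0 L m)%:E)%E.

End Network.

(* Main.v *)
Require Import Defs.
From HB Require Import structures.
From mathcomp Require Import all_boot all_order all_algebra.
From mathcomp Require Import all_classical all_reals all_analysis.
From mathcomp Require Import finmap ring lra.
Set Implicit Arguments. Unset Strict Implicit. Unset Printing Implicit Defensive.
Import Order.TTheory GRing.Theory Num.Theory.
Import numFieldNormedType.Exports.
Local Open Scope classical_set_scope.
Local Open Scope ring_scope.

(** Write [B] for the normalizing constant, [a j i] for [1 / mu j i] on the
    routes and [T i N = B (N - e_i) / B N] for the stationary throughput.  Moving
    one customer in or out of a queue gives three exact facts.
    - [T] is feasible: [\sum_i a j i * T i N <= 1], the left side being the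
      probability that queue [j] is busy.
    - By Cauchy-Schwarz [N_i! * B N] is log-convex in [N_i]; combined with the
      feasibility of [Lam] this yields
      [\sum_i Lam i * N i / T i N <= \sum_i N i + #|J|].
    - The mean number of route-[i] customers at [j] is
      [a j i * T i N * (1 + mean number at j with population N - e_i)].
    Optimality of [Lam] gives [\sum_i n i * T i N / Lam i <= \sum_i n i], and for
    [N] near [c n] the sum of the first-order and log-convexity bounds reads
    [\sum_i n i * (Lam i / T i + T i / Lam i - 2) = o(1)], so [T i -> Lam i]
    whenever [n i > 0].  If [n i = 0], uniqueness of [Lam] forces [Lam i = 0] and
    a saturated queue on route [i], where feasibility leaves no room: [T i -> 0].
    At a non-bottleneck queue the recursion for the means is then a contraction,
    which is iterated of order [c] times against the trivial bound
    [\sum_i N i]; its fixed point is the mean of the limiting law. *)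

(** * States and the shift identity *)

Section States.
Variables (R : realType) (J I : finType).
Implicit Types (b : J -> I -> R) (m : J -> I -> nat) (N : I -> nat).
Implicit Types h : (J -> I -> nat) -> R.

Definition qlen m (j : J) : nat := \sum_i m j i.

Definition clen m (i : I) : nat := \sum_j m j i.

(* Off the routes [b j i] is [0]; as [0 ^+ 0 = 1], the weight then vanishes
   on every state with a misplaced customer, so no support condition is needed. *)
Definition wgt b m : R :=
  \prod_j ((qlen m j)`!%:R / \prod_i (m j i)`!%:R * \prod_i b j i ^+ m j i).

Definition addc (j : J) (i : I) m : J -> I -> nat :=
  fun j' i' => (m j' i' + ((j' == j) && (i' == i)))%N.

Lemma qlen_addc j i m j' : qlen (addc j i m) j' = (qlen m j' + (j' == j))%N.
Proof.
rewrite /qlen /addc big_split /=; congr addn.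
rewrite (bigD1 i)//= eqxx andbT big1 ?addn0// => k /negbTE ->.
by rewrite andbF.
Qed.

Lemma clen_addc j i m i' : clen (addc j i m) i' = (clen m i' + (i' == i))%N.
Proof.
rewrite /clen /addc big_split /=; congr addn.
by rewrite (bigD1 j)//= eqxx big1 ?addn0// => k /negbTE ->.
Qed.

Lemma addc_inj j i : injective (addc j i).
Proof.
move=> m m' /funeqP e; apply/funext => k; apply/funext => l.
by have /funeqP/(_ l) := e k; rewrite /addc => /addIn.
Qed.

Lemma wgt_ge0 b m : (forall j i, 0 <= b j i) -> 0 <= wgt b m.
Proof.
move=> b0; apply: prodr_ge0 => j _; apply: mulr_ge0.
  by rewrite divr_ge0// ?prodr_ge0.
by apply: prodr_ge0 => i _; rewrite exprn_ge0.
Qed.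

(** Only row [j] changes: the numerator gains [(qlen m j).+1], the denominator [(m j i).+1], and the
    rates one factor [b j i]. *)
Lemma wgt_addc b j i m :
  wgt b (addc j i m) * (m j i).+1%:R = b j i * (qlen m j).+1%:R * wgt b m.
Proof.
rewrite /wgt (bigD1 j)//= [in RHS](bigD1 j)//=.
rewrite [X in _ * X * _ = _](_ : _ = \prod_(k | k != j)
   ((qlen m k)`!%:R / \prod_l (m k l)`!%:R * \prod_l b k l ^+ m k l)); last first.
  apply: eq_bigr => k kj; rewrite qlen_addc (negbTE kj) addn0.
  congr (_ / _ * _); apply: eq_bigr => l _;
    by rewrite /addc (negbTE kj) addn0.
set P := \prod_(k | k != j) _.
rewrite qlen_addc eqxx addn1 factS natrM.
rewrite [\prod_l (addc j i m j l)`!%:R](bigD1 i)//=.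
rewrite [\prod_l b j l ^+ addc j i m j l](bigD1 i)//=.
rewrite [\prod_l (m j l)`!%:R](bigD1 i)//=.
rewrite [\prod_l b j l ^+ m j l](bigD1 i)//=.
have -> : \prod_(l | l != i) (addc j i m j l)`!%:R
    = \prod_(l | l != i) (m j l)`!%:R :> R.
  by apply: eq_bigr => l li; rewrite /addc (negbTE li) andbF addn0.
have -> : \prod_(l | l != i) b j l ^+ addc j i m j l
    = \prod_(l | l != i) b j l ^+ m j l.
  by apply: eq_bigr => l li; rewrite /addc (negbTE li) andbF addn0.
rewrite /addc !eqxx /= addn1 factS natrM exprS.
set Q := \prod_(l | _) _; set S := \prod_(l | _) _.
have Q0 : Q != 0 by apply/prodf_neq0 => l _; rewrite pnatr_eq0 -lt0n fact_gt0.
have f0 : (m j i)`!%:R != 0 :> R by rewrite pnatr_eq0 -lt0n fact_gt0.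
have s0 : (m j i).+1%:R != 0 :> R by rewrite pnatr_eq0.
move: s0 f0; move: (m j i).+1%:R (m j i)`!%:R => s f s0 f0.
by field; rewrite s0 f0 Q0.
Qed.

Definition pop N : set (J -> I -> nat) := [set m | forall i, clen m i = N i].

Definition incr (i : I) N : I -> nat := fun k => (N k + (k == i))%N.

Lemma le_pop N m j i : pop N m -> (m j i <= N i)%N.
Proof. by move=> <-; rewrite /clen (bigD1 j)//= leq_addr. Qed.

Lemma finite_pop N : finite_set (pop N).
Proof.
pose D := (\max_i N i)%N.
pose f (g : {ffun J -> {ffun I -> 'I_D.+1}}) : J -> I -> nat := fun j i => g j i.
apply: (@sub_finite_set _ _ (f @` setT)); last first.
  exact/finite_image/finite_finset.
move=> m mN /=.
exists [ffun j => [ffun i => inord (m j i)]] => //.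
apply/funext => j; apply/funext => i; rewrite /f !ffunE inordK//.
rewrite ltnS (leq_trans (le_pop _ _ mN))//; exact: leq_bigmax.
Qed.

Definition psum b N h : R := \sum_(m <- fset_set (pop N)) wgt b m * h m.

Lemma psumE b N h : psum b N h = \sum_(m \in pop N) wgt b m * h m.
Proof. by rewrite /psum fsbig_finite//; exact: finite_pop. Qed.

Lemma eq_psum b N h h' : (forall m, pop N m -> h m = h' m) ->
  psum b N h = psum b N h'.
Proof.
by move=> e; rewrite !psumE; apply: eq_fsbigr => m /set_mem /e ->.
Qed.

Lemma psumD b N h h' : psum b N (fun m => h m + h' m) = psum b N h + psum b N h'.
Proof. by rewrite /psum -big_split /=; apply: eq_bigr => m _; rewrite mulrDr. Qed.

Lemma psumZ b N k h : psum b N (fun m => k * h m) = k * psum b N h.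
Proof. by rewrite /psum mulr_sumr; apply: eq_bigr => m _; rewrite mulrCA. Qed.

Lemma psum_sum b N (K : finType) (P : pred K) (h : K -> (J -> I -> nat) -> R) :
  psum b N (fun m => \sum_(k | P k) h k m) = \sum_(k | P k) psum b N (h k).
Proof.
by rewrite /psum exchange_big /=; apply: eq_bigr => m _; rewrite mulr_sumr.
Qed.

Lemma le_psum b N h h' : (forall j i, 0 <= b j i) ->
  (forall m, pop N m -> h m <= h' m) -> psum b N h <= psum b N h'.
Proof.
move=> b0 hh'; rewrite /psum big_seq [leRHS]big_seq; apply: ler_sum => m.
rewrite in_fset_set; last exact: finite_pop.
by move=> /set_mem /hh' ?; rewrite ler_wpM2l// wgt_ge0.
Qed.

(** The set [X] is arbitrary so that the same bijection reindexes the finite sums over [pop N] and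
    the infinite sums of the open network. *)
Lemma addc_bij j i (X : set (J -> I -> nat)) :
  set_bij (addc j i @^-1` X) (X `&` [set m | m j i != 0%N]) (addc j i).
Proof.
split.
- by move=> m mX; split=> //=; rewrite /addc !eqxx addn1.
- by move=> m m' _ _ /addc_inj.
- move=> m [mX /= m0].
  pose m' := fun k l => (m k l - ((k == j) && (l == i)))%N.
  have mm' : addc j i m' = m.
    apply/funext => k; apply/funext => l; rewrite /addc /m'.
    case: (eqVneq k j) => [->|] /=; last by rewrite subn0 addn0.
    case: (eqVneq l i) => [->|] /=; last by rewrite subn0 addn0.
    by rewrite subnK// lt0n.
  by exists m' => //=; rewrite mm'.
Qed.

Lemma preimage_pop j i N : addc j i @^-1` pop (incr i N) = pop N.
Proof.
apply/seteqP; split=> m mN k; have := mN k; rewrite clen_addc /incr.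
  by move=> /addIn.
by move=> ->.
Qed.

(** The factor [m j i] kills the states without a route-[i] customer at [j]; the others are
    [addc j i] of a unique state of population [N]. The arrival theorem, the feasibility of [thr]
    and the log-convexity of [pf] come from choices of [h]. *)
Lemma psum_shift b N h j i :
  psum b (incr i N) (fun m => (m j i)%:R * h m) =
  b j i * psum b N (fun m => (qlen m j).+1%:R * h (addc j i m)).
Proof.
rewrite !psumE mulr_fsumr.
rewrite -(@fsbig_widen _ _ _ _ (pop (incr i N) `&` [set m | m j i != 0%N])) /=.
- rewrite (reindex_fsbig _ _ _ _ (addc_bij j i _)) preimage_pop; apply: eq_fsbigr => m _.
  rewrite mulrA {2}/addc !eqxx addn1 wgt_addc; ring.
- exact: subIsetl.
- move=> m [mN /= /not_andP[//|/negP]]; rewrite negbK => /eqP ->.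
  by rewrite mul0r mulr0.
Qed.

End States.

(** * Closed network *)

Section ClosedNetwork.
Variables (R : realType) (J I : finType) (a : J -> I -> R).
Hypothesis a_ge0 : forall j i, 0 <= a j i.
Hypothesis a_served : forall i, exists j, 0 < a j i.
Implicit Types (m : J -> I -> nat) (N : I -> nat) (h : (J -> I -> nat) -> R).

Definition pf N : R := psum a N (fun=> 1).

Definition decr (i : I) N : I -> nat := fun k => (N k - (k == i))%N.

(* The test is needed because [decr i N = N] when [N i = 0]. *)
Definition thr (i : I) N : R := if N i == 0%N then 0 else pf (decr i N) / pf N.

Definition meanq N (j : J) (i : I) : R := psum a N (fun m => (m j i)%:R) / pf N.

(** The insertion factor of [psum_shift] summed over the queues; by [pf_incr] its mean is
    [(N i).+1 / thr i (incr i N)]. *)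
Definition load (i : I) m : R := \sum_j a j i * (qlen m j).+1%:R.

Lemma incrK i N : N i != 0%N -> incr i (decr i N) = N.
Proof.
move=> Ni; apply/funext => k; rewrite /incr /decr.
by case: eqVneq => [->|_]; rewrite ?subn0 ?addn0// subnK// lt0n.
Qed.

Lemma psum_ge0 N h : (forall m, pop N m -> 0 <= h m) -> 0 <= psum a N h.
Proof.
move=> h0; rewrite -[leLHS](_ : psum a N (fun=> 0) = 0); first exact: le_psum.
by rewrite /psum big1// => m _; rewrite mulr0.
Qed.

Lemma pf_gt0 N : 0 < pf N.
Proof.
have /choice[f fP] := a_served.
(* Parking all customers of route [i] at one queue [f i] that serves it gives a state of positive
   weight. *)
pose m := fun j i => if j == f i then N i else 0%N.
have mN : pop N m.
  by move=> i; rewrite /clen (bigD1 (f i))//= /m eqxx big1 ?addn0// => j /negbTE ->.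
rewrite /pf psumE (fsbigD1 m)//=; last exact: finite_pop.
apply: ltr_pwDl; last by apply: fsumr_ge0 => ? _; rewrite mulr1 wgt_ge0.
rewrite mulr1 /wgt prodr_gt0// => j _; rewrite mulr_gt0//.
  by rewrite divr_gt0 ?prodr_gt0// => *; rewrite ltr0n fact_gt0.
rewrite prodr_gt0// => i _; rewrite /m; case: eqVneq => [->|_]; last by rewrite expr0.
by rewrite exprn_gt0.
Qed.

Lemma sum_qlen N m : pop N m -> (\sum_j qlen m j = \sum_i N i)%N.
Proof.
move=> mN; rewrite /qlen exchange_big /=; apply: eq_bigr => i _; exact: mN.
Qed.

Lemma psum_clen i N h : (N i).+1%:R * psum a (incr i N) h =
  \sum_j a j i * psum a N (fun m => (qlen m j).+1%:R * h (addc j i m)).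
Proof.
under [RHS]eq_bigr do rewrite -psum_shift.
rewrite -psum_sum -psumZ; apply: eq_psum => m /(_ i) mN.
rewrite -mulr_suml -natr_sum; congr (_%:R * _).
by rewrite -/(clen m i) mN /incr eqxx addn1.
Qed.

Lemma pf_incr i N : (N i).+1%:R * pf (incr i N) = psum a N (load i).
Proof.
rewrite psum_clen psum_sum; apply: eq_bigr => j _.
by rewrite -psumZ; apply: eq_psum => m _; rewrite mulr1.
Qed.

Lemma load_ge0 i m : 0 <= load i m.
Proof. by apply: sumr_ge0 => j _; rewrite mulr_ge0. Qed.

Lemma le_load_addc i j m : load i m <= load i (addc j i m).
Proof.
apply: ler_sum => k _; rewrite ler_wpM2l// ler_nat ltnS qlen_addc; exact: leq_addr.
Qed.

(** Cauchy-Schwarz, from the nonnegative variance of [h] about its mean [psum a N h / pf N]. *)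
Lemma psum_sqr N h : psum a N h ^+ 2 <= pf N * psum a N (fun m => h m ^+ 2).
Proof.
have Z0 := pf_gt0 N; set X := psum a N h; set Y := psum a N _.
have : 0 <= psum a N (fun m => (h m - X / pf N) ^+ 2).
  by apply: psum_ge0 => m _; exact: sqr_ge0.
have -> : psum a N (fun m => (h m - X / pf N) ^+ 2) =
    psum a N (fun m => h m ^+ 2 + ((- (2 * (X / pf N))) * h m + (X / pf N) ^+ 2 * 1)).
  by apply: eq_psum => m _; ring.
rewrite !psumD !psumZ -/X -/Y -/(pf N) => H.
rewrite -subr_ge0.
have -> : pf N * Y - X ^+ 2 =
    pf N * (Y + (- (2 * (X / pf N)) * X + (X / pf N) ^+ 2 * pf N)).
  by field; rewrite gt_eqF.
by rewrite mulr_ge0// ltW.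
Qed.

(* Equivalently, [(N i)`! * pf N] is log-convex in [N i]: up to the other
   factorials it is the moment E[prod_k (sum_j a j k * X_j)^(N k)] for independent
   standard exponential [X_j]. *)
Lemma pf_logconvex i N : (N i).+1%:R * pf (incr i N) ^+ 2 <=
  (N i).+2%:R * pf N * pf (incr i (incr i N)).
Proof.
have Z0 := pf_gt0 N.
have e1 := pf_incr i N.
have := pf_incr i (incr i N); rewrite {1}/incr eqxx addn1 => e2.
have e3 := psum_clen i N (load i).
(* An extra customer can only raise the load, so the second moment of [load i] is at most the double
   insertion sum, which [e3] and [e2] express through [pf (incr i (incr i N))]. *)
have le3 : psum a N (fun m => load i m ^+ 2) <=
    \sum_j a j i * psum a N (fun m => (qlen m j).+1%:R * load i (addc j i m)).
  rewrite [leLHS](_ : _ = \sum_j a j i * psum a N (fun m => (qlen m j).+1%:R * load i m)).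
    apply: ler_sum => j _; rewrite ler_wpM2l// le_psum// => m _.
    by rewrite ler_wpM2l// le_load_addc.
  under [RHS]eq_bigr do rewrite -psumZ.
  rewrite -psum_sum; apply: eq_psum => m _.
  by rewrite expr2 {1}/load mulr_suml; apply: eq_bigr => j _; rewrite mulrA.
have cs := psum_sqr N (load i).
rewrite -e3 -e2 in le3; rewrite -e1 in cs.
have p0 : 0 < (N i).+1%:R :> R by rewrite ltr0n.
rewrite -(ler_pM2l p0).
have H := le_trans cs (ler_wpM2l (ltW Z0) le3).
lra.
Qed.

Lemma thr_ge0 i N : 0 <= thr i N.
Proof. by rewrite /thr; case: ifP => // _; rewrite divr_ge0// ltW// pf_gt0. Qed.

Lemma thr_gt0 i N : N i != 0%N -> 0 < thr i N.
Proof. by rewrite /thr => /negbTE ->; rewrite divr_gt0// pf_gt0. Qed.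

Lemma psum_off N h j i : N i = 0%N -> psum a N (fun m => (m j i)%:R * h m) = 0.
Proof.
move=> Ni; rewrite /psum big_seq big1// => m.
rewrite in_fset_set; last exact: finite_pop.
by move=> /set_mem/(le_pop j i); rewrite Ni leqn0 => /eqP ->; rewrite mul0r mulr0.
Qed.

(** By log-convexity [N i * pf N / pf (decr i N)] is at most the same ratio with one more customer,
    and that ratio is the mean load by [pf_incr]. *)
Lemma div_thr_le i N : (N i)%:R / thr i N <= psum a N (load i) / pf N.
Proof.
have [Ni|Ni] := eqVneq (N i) 0%N.
  rewrite Ni mul0r divr_ge0// ?(ltW (pf_gt0 N))//.
  by apply: psum_ge0 => *; exact: load_ge0.
rewrite /thr (negbTE Ni) -pf_incr.
move: (decr i N) (incrK Ni) => M <-.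
have := pf_logconvex i M; rewrite (_ : incr i M i = (M i).+1); last first.
  by rewrite /incr eqxx addn1.
have := pf_gt0 M; have := pf_gt0 (incr i M).
move: (pf M) (pf (incr i M)) (pf (incr i (incr i M))) => x y z y0 x0 H.
rewrite invf_div mulrA ler_pdivrMr// mulrAC ler_pdivlMr//.
lra.
Qed.

(** With each quotient replaced by a mean load, queue [j] contributes [qlen m j + 1] times its
    utilization under [L], which is at most [1]. *)
Lemma sum_thr_le (L : I -> R) N : (forall i, 0 <= L i) ->
    (forall j, \sum_i a j i * L i <= 1) ->
  \sum_i L i * ((N i)%:R / thr i N) <= (\sum_i N i)%:R + #|J|%:R.
Proof.
move=> L0 L1; have Z0 := pf_gt0 N.
apply: (@le_trans _ _ (\sum_i L i * (psum a N (load i) / pf N))).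
  by apply: ler_sum => i _; rewrite ler_wpM2l// div_thr_le.
under [leLHS]eq_bigr do rewrite mulrA -psumZ.
rewrite -mulr_suml -psum_sum ler_pdivrMr// -psumZ le_psum// => m mN.
rewrite mulr1 -(sum_qlen mN) -[#|J|]sum1_card -natrD -big_split /= natr_sum.
under [leLHS]eq_bigr do rewrite /load mulr_sumr.
rewrite exchange_big /=; apply: ler_sum => j _.
under [leLHS]eq_bigr do rewrite mulrA [L _ * _]mulrC.
by rewrite -mulr_suml addn1 ler_piMl.
Qed.

Lemma thr_feasible j N : \sum_i a j i * thr i N <= 1.
Proof.
have Z0 := pf_gt0 N.
rewrite -(ler_pM2r Z0) mul1r mulr_suml.
(* [a j i * thr i N] is the mean of [m j i / qlen m j]. Over all routes these fractions add up to
   the indicator that queue [j] is busy; an empty queue gives [0] since [0^-1 = 0]. *)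
rewrite (eq_bigr (fun i => psum a N (fun m => (m j i)%:R * (qlen m j)%:R^-1))).
  rewrite -psum_sum; apply: le_psum => // m _.
  rewrite -mulr_suml -natr_sum -/(qlen m j).
  by have [->|q0] := eqVneq (qlen m j) 0%N; rewrite ?mul0r// divff// pnatr_eq0.
move=> i _; rewrite /thr; have [Ni|Ni] := eqVneq (N i) 0%N.
  by rewrite psum_off// mulr0 mul0r.
rewrite mulrA divfK ?gt_eqF// -{2}(incrK Ni) psum_shift; congr (_ * _).
apply: eq_psum => m _; rewrite qlen_addc eqxx addn1 divff// pnatr_eq0//.
Qed.

Lemma meanq_ge0 N j i : 0 <= meanq N j i.
Proof. by rewrite divr_ge0// ?(ltW (pf_gt0 N))// psum_ge0. Qed.

Lemma sum_meanq_le N j : \sum_i meanq N j i <= (\sum_i N i)%:R.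
Proof.
rewrite -mulr_suml -psum_sum ler_pdivrMr ?pf_gt0// -psumZ le_psum// => m mN.
by rewrite mulr1 -(sum_qlen mN) -natr_sum ler_nat (bigD1 j)//= leq_addr.
Qed.

(* The arrival theorem: a customer entering queue [j] sees the stationary
   network without itself. *)
Lemma meanq_rec N j i :
  meanq N j i = a j i * thr i N * (1 + \sum_k meanq (decr i N) j k).
Proof.
rewrite /meanq /thr; have [Ni|Ni] := eqVneq (N i) 0%N.
  rewrite (_ : psum _ _ _ = psum a N (fun m => (m j i)%:R * 1)).
    by rewrite psum_off// mulr0 !mul0r.
  by apply: eq_psum => m _; rewrite mulr1.
set M := decr i N.
rewrite -mulr_suml -psum_sum.
rewrite (_ : psum _ _ _ = psum a (incr i M) (fun m => (m j i)%:R * 1)); last first.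
  by rewrite incrK//; apply: eq_psum => m _; rewrite mulr1.
rewrite psum_shift.
rewrite (_ : psum a M _ = pf M + psum a M (fun m => \sum_k (m j k)%:R)).
  by field; rewrite !gt_eqF// pf_gt0.
by rewrite -psumD; apply: eq_psum => m _; rewrite mulr1 -natr_sum -natr1 addrC.
Qed.

End ClosedNetwork.

(** * Optimality conditions *)

(** This is [ln y <= y - 1] at [y = (1 + x)^-1]. The quadratic error gives first-order optimality
    without derivatives. *)
Lemma ln1D_ge (R : realType) (x : R) : - 2^-1 <= x -> x - 2 * x ^+ 2 <= ln (1 + x).
Proof.
move=> hx; have x1 : 0 < 1 + x by lra.
have H : ln ((1 + x)^-1) <= (1 + x)^-1 - 1.
  rewrite -{1}[(1 + x)^-1](subrK 1) addrC.
  by apply: le_ln1Dx; rewrite ltrBrDl subrr invr_gt0.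
rewrite lnV ?posrE// in H.
suff : (1 + x)^-1 - 1 <= 2 * x ^+ 2 - x by lra.
rewrite -subr_ge0.
have -> : 2 * x ^+ 2 - x - ((1 + x)^-1 - 1) = x ^+ 2 * (1 + 2 * x) / (1 + x).
  by field; rewrite gt_eqF.
apply: divr_ge0; last exact: ltW.
by apply: mulr_ge0; [exact: sqr_ge0|lra].
Qed.

Definition srv (R : realType) (J I : finType) (route : I -> J -> bool)
  (mu : J -> I -> R) (j : J) (i : I) : R := if route i j then (mu j i)^-1 else 0.

Section Optimizer.
Variables (R : realType) (J I : finType) (route : I -> J -> bool).
Variables (mu : J -> I -> R) (n Lam : I -> R).
Hypothesis hmu : forall j i, route i j -> 0 < mu j i.
Hypothesis hn : forall i, 0 <= n i.
Hypothesis hopt : is_optimizer route mu n Lam.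
Hypothesis huniq : forall L, is_optimizer route mu n L -> L = Lam.

Local Notation a := (srv route mu).

Lemma srv_ge0 j i : 0 <= a j i.
Proof. by rewrite /srv; case: ifP => // /hmu ?; rewrite invr_ge0 ltW. Qed.

Lemma sum_srv (L : I -> R) j : \sum_(i | route i j) L i / mu j i = \sum_i a j i * L i.
Proof.
rewrite big_mkcond; apply: eq_bigr => i _; rewrite /srv; case: ifP => _.
  by rewrite mulrC.
by rewrite mul0r.
Qed.

Lemma feasible_srv (L : I -> R) : (forall i, 0 <= L i) ->
  (forall j, \sum_i a j i * L i <= 1) -> feasible route mu L.
Proof. by move=> L0 L1; split=> // j; rewrite sum_srv. Qed.

Lemma Lam_ge0 i : 0 <= Lam i.
Proof. by case: hopt => [[[]]]. Qed.

Lemma Lam_le1 j : \sum_i a j i * Lam i <= 1.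
Proof. by case: hopt => [[[_ H] _] _]; rewrite -sum_srv. Qed.

Lemma Lam_gt0 i : 0 < n i -> 0 < Lam i.
Proof. by case: hopt => [[_ H] _]; exact: H. Qed.

Lemma optimizer_eq L : admissible route mu n L ->
  objective n Lam <= objective n L -> L = Lam.
Proof.
move=> Ladm LL; apply: huniq; split=> // L' /(proj2 hopt) h.
exact: le_trans LL.
Qed.

Lemma objective_set i x : (0 < n i -> Lam i <= x) ->
  objective n Lam <= objective n (fun k => if k == i then x else Lam k).
Proof.
move=> H; apply: ler_sum => k _; case: eqVneq => // ->.
have [ni|ni] := ltP 0 (n i); last first.
  by have /eqP -> : n i == 0 by [rewrite eq_le ni hn]; rewrite !mul0r.
rewrite ler_wpM2l// ler_ln ?posrE ?H ?Lam_gt0//.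
by rewrite (lt_le_trans (Lam_gt0 ni))// H.
Qed.

Lemma Lam_eq0 i : n i = 0 -> Lam i = 0.
Proof.
move=> ni; pose L := fun k => if k == i then 0 else Lam k.
suff /funeqP/(_ i) : L = Lam by rewrite /L eqxx.
apply: optimizer_eq; last by apply: objective_set; rewrite ni ltxx.
split; last first.
  by move=> k nk; rewrite /L; case: eqVneq nk => [->|_]; [rewrite ni ltxx|exact: Lam_gt0].
apply: feasible_srv => [k|j]; first by rewrite /L; case: ifP => // _; exact: Lam_ge0.
apply: le_trans (Lam_le1 j); apply: ler_sum => k _; rewrite ler_wpM2l ?srv_ge0//.
by rewrite /L; case: ifP => // _; exact: Lam_ge0.
Qed.

(** If every queue on the route had slack, [Lam i] could be raised without lowering the objective,
    against uniqueness. This includes the case [n i = 0] and shows that no route is empty. *)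
Lemma saturated_queue i : exists2 j, route i j & \sum_k a j k * Lam k = 1.
Proof.
apply: contrapT => H.
have slack j : route i j -> \sum_k a j k * Lam k < 1.
  move=> rj; rewrite lt_neqAle Lam_le1 andbT; apply/eqP => e.
  by apply: H; exists j.
(* An increase that fits at every queue of the route; the cap [1] is its value should the route be
   empty. *)
pose e := \big[Order.min/1]_(j | route i j) ((1 - \sum_k a j k * Lam k) * mu j i).
have e0 : 0 < e.
  by apply: lt_bigmin => // j rj; rewrite mulr_gt0 ?hmu// subr_gt0 slack.
pose L := fun k => if k == i then Lam i + e else Lam k.
suff /funeqP/(_ i) : L = Lam by rewrite /L eqxx; lra.
apply: optimizer_eq; last by apply: objective_set => _; lra.
split; last first.
  move=> k /Lam_gt0 nk; rewrite /L; case: eqVneq => [_|//].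
  by have := Lam_ge0 i; lra.
apply: feasible_srv => [k|j].
  by rewrite /L; case: ifP => _; have := Lam_ge0 k; have := Lam_ge0 i; lra.
have -> : \sum_k a j k * L k = \sum_k a j k * Lam k + a j i * e.
  rewrite (bigD1 i)//= [in RHS](bigD1 i)//= {1}/L eqxx.
  rewrite [X in _ + X = _](eq_bigr (fun k => a j k * Lam k)); first by ring.
  by move=> k /negbTE ki; rewrite /L ki.
have [rj|/negbTE rj] := boolP (route i j); last by rewrite {2}/srv rj mul0r addr0 Lam_le1.
have : e <= (1 - \sum_k a j k * Lam k) * mu j i by exact: bigmin_le_cond.
rewrite -ler_pdivrMr ?hmu// {3}/srv rj => ?; rewrite mulrC; lra.
Qed.

Lemma srv_served i : exists j, 0 < a j i.
Proof.
have [j rj _] := saturated_queue i; exists j.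
by rewrite /srv rj invr_gt0 hmu.
Qed.

(* First-order optimality, along the segment from [Lam] to [T]. *)
Lemma sum_ratio_le (T : I -> R) : (forall i, 0 <= T i) ->
  (forall j, \sum_i a j i * T i <= 1) ->
  \sum_i n i * (T i / Lam i) <= \sum_i n i.
Proof.
move=> T0 T1; pose x i := T i / Lam i - 1.
suff : \sum_i n i * x i <= 0.
  rewrite /x; under eq_bigr do rewrite mulrBr mulr1.
  by rewrite sumrB subr_le0.
pose K := \sum_i n i * x i ^+ 2.
have K0 : 0 <= K by apply: sumr_ge0 => i _; rewrite mulr_ge0 ?sqr_ge0.
(* Compare [Lam] with the point at parameter [t] of the segment: by [ln1D_ge] the error is quadratic
   in [t], hence linear after division by [t]. The bound on [t] ensures [t * x i >= - 2^-1]. *)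
have main t : 0 < t -> t <= 2^-1 -> \sum_i n i * x i <= t * (2 * K).
  move=> t0 t2; pose L i := (1 - t) * Lam i + t * T i.
  have adm : admissible route mu n L.
    split; last first.
      move=> i /Lam_gt0 Li; rewrite /L.
      have : 0 < (1 - t) * Lam i by rewrite mulr_gt0//; lra.
      by have : 0 <= t * T i by [rewrite mulr_ge0// ltW]; lra.
    apply: feasible_srv => [i|j].
      by rewrite /L addr_ge0// mulr_ge0 ?Lam_ge0//; lra.
    rewrite (eq_bigr (fun i => (1 - t) * (a j i * Lam i) + t * (a j i * T i))).
      rewrite big_split /= -!mulr_sumr.
      have : (1 - t) * (\sum_i a j i * Lam i) <= (1 - t) * 1.
        by rewrite ler_wpM2l ?Lam_le1//; lra.
      have : t * (\sum_i a j i * T i) <= t * 1 by rewrite ler_wpM2l// ltW.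
      lra.
    by move=> i _; rewrite /L; ring.
  have := proj2 hopt _ adm; rewrite -subr_ge0 /objective -sumrB => opt.
  have : \sum_i n i * (t * x i - 2 * (t * x i) ^+ 2) <= 0.
    rewrite -oppr_ge0; apply: le_trans opt _; rewrite -sumrN.
    apply: ler_sum => i _.
    have := hn i; rewrite le_eqVlt => /predU1P[<-|ni]; first by rewrite !mul0r subrr oppr0.
    have Li := Lam_gt0 ni.
    have -> : L i = Lam i * (1 + t * x i) by rewrite /L /x; field; rewrite gt_eqF.
    have hx : - 2^-1 <= t * x i.
      have : 0 <= t * (T i / Lam i) by apply: mulr_ge0; [exact: ltW|rewrite divr_ge0 ?Lam_ge0].
      by rewrite /x mulrBr; lra.
    rewrite lnM ?posrE//; last by lra.
    have := ler_wpM2l (hn i) (ln1D_ge hx); lra.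
  rewrite (eq_bigr (fun i => t * (n i * x i) - t * (t * (2 * (n i * x i ^+ 2))))).
    rewrite sumrB -!mulr_sumr -/K -mulrBr pmulr_rle0//; lra.
  by move=> i _; ring.
apply/ler_addgt0Pr => e e0; rewrite add0r.
pose t := Num.min 2^-1 (e / (2 * K + 1)).
have t0 : 0 < t by rewrite lt_min invr_gt0 ltr0n/= divr_gt0//; lra.
apply: le_trans (main t t0 _) _; first by rewrite ge_min lexx.
apply: (@le_trans _ _ (e / (2 * K + 1) * (2 * K))).
  by rewrite ler_wpM2r ?ge_min ?lexx ?orbT//; lra.
rewrite mulrAC ler_pdivrMr; last by lra.
by rewrite ler_wpM2l//; lra.
Qed.

End Optimizer.

(** * Throughput limit *)

(** Estimates are made uniform in a cone around the ray because the recursion for the means leaves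
    the given sequence of populations. The first clause excludes [c = 0] and makes [1 / c] an error
    of order [d]. *)
Definition near_ray (R : realType) (I : finType) (n : I -> R) (d : R) (c : nat)
    (N : I -> nat) : Prop :=
  1 <= d * c%:R /\ forall k, `|(N k)%:R - c%:R * n k| <= d * c%:R.

Lemma near_ray_le (R : realType) (I : finType) (n : I -> R) d e c N :
  d <= e -> near_ray n d c N -> near_ray n e c N.
Proof.
move=> de [d1 dN]; have dec : d * c%:R <= e * c%:R by rewrite ler_wpM2r.
by split=> [|k]; [exact: le_trans dec|exact: le_trans dec].
Qed.

Lemma near_ray_forall (R : realType) (I K : finType) (n : I -> R)
    (P : K -> (I -> nat) -> Prop) :
  (forall k, exists2 d, 0 < d & forall c N, near_ray n d c N -> P k N) ->
  exists2 d, 0 < d & forall c N, near_ray n d c N -> forall k, P k N.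
Proof.
move=> H.
have /choice[d /all_and2[d0 dP]] : forall k, exists d,
    0 < d /\ forall c N, near_ray n d c N -> P k N.
  by move=> k; have [d] := H k; exists d.
exists (\big[Order.min/1]_k d k); first by apply: lt_bigmin.
move=> c N Hc k; apply: (dP k c); apply: near_ray_le Hc; exact: bigmin_le_cond.
Qed.

Section ThroughputLimit.
Variables (R : realType) (J I : finType) (route : I -> J -> bool).
Variables (mu : J -> I -> R) (n Lam : I -> R).
Hypothesis hmu : forall j i, route i j -> 0 < mu j i.
Hypothesis hn : forall i, 0 <= n i.
Hypothesis hopt : is_optimizer route mu n Lam.
Hypothesis huniq : forall L, is_optimizer route mu n L -> L = Lam.

Local Notation a := (srv route mu).
Local Notation T := (thr a).

Let a_ge0 : forall j i, 0 <= a j i := srv_ge0 hmu.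
Let a_served : forall i, exists j, 0 < a j i := srv_served hmu hn hopt huniq.
Let L_ge0 := Lam_ge0 hopt.

Lemma thr_bounded : exists2 M, 0 < M & forall i N, T i N <= M.
Proof.
have /choice[f fP] := a_served.
exists (1 + \sum_i (a (f i) i)^-1).
  by apply: ltr_pwDl => //; apply: sumr_ge0 => i _; rewrite invr_ge0.
move=> i N.
have : T i N <= (a (f i) i)^-1.
  rewrite -[leRHS]mul1r ler_pdivlMr// mulrC.
  apply: le_trans (thr_feasible a_ge0 a_served (f i) N).
  rewrite (bigD1 i)//= lerDl; apply: sumr_ge0 => k _.
  by rewrite mulr_ge0// thr_ge0.
have : (a (f i) i)^-1 <= \sum_i (a (f i) i)^-1.
  by rewrite (bigD1 i)//= lerDl; apply: sumr_ge0 => k _; rewrite invr_ge0.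
lra.
Qed.

Lemma thr_near_sqr i : 0 < n i -> exists2 K, 0 <= K &
  forall d c N, 0 < d -> d <= n i / 2 -> near_ray n d c N ->
    (T i N - Lam i) ^+ 2 <= K * d.
Proof.
move=> ni; have [M M0 TM] := thr_bounded.
have Li : 0 < Lam i := Lam_gt0 hopt ni.
pose K1 := #|J|%:R + \sum_k (1 + M / Lam k).
have K10 : 0 <= K1.
  rewrite addr_ge0//; apply: sumr_ge0 => k _.
  by have := divr_ge0 (ltW M0) (L_ge0 k); lra.
exists (K1 * M * Lam i * 2 / n i).
  by rewrite !mulr_ge0// ?invr_ge0// ltW.
move=> d c N d0 dn [d1 dN].
have c0 : 0 < c%:R :> R.
  by rewrite lt_neqAle ler0n andbT; apply/eqP => c0; move: d1; rewrite -c0; lra.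
pose v k := (N k)%:R / c%:R : R.
have v0 k : 0 <= v k by rewrite divr_ge0.
have vn k : `|v k - n k| <= d.
  have -> : v k - n k = ((N k)%:R - c%:R * n k) / c%:R.
    by rewrite /v; field; rewrite gt_eqF.
  by rewrite normrM normfV (gtr0_norm c0) ler_pdivrMr.
have T0 k : 0 <= T k N := thr_ge0 a_ge0 a_served k N.
have Nv k : 0 < v k -> 0 < T k N.
  move=> vk; apply: thr_gt0 => //; apply/eqP => Nk; move: vk.
  by rewrite /v Nk mul0r ltxx.
have upper : \sum_k Lam k * (v k / T k N) <= \sum_k v k + d * #|J|%:R.
  have := sum_thr_le a_ge0 a_served N L_ge0 (Lam_le1 hopt).
  have ci : 0 <= c%:R^-1 :> R by rewrite invr_ge0.
  move=> /(ler_wpM2r ci) h; apply: le_trans (le_trans h _).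
    rewrite mulr_suml; apply: ler_sum => k _; rewrite /v.
    by rewrite le_eqVlt; apply/orP; left; apply/eqP; ring.
  rewrite mulrDl natr_sum mulr_suml lerD2l mulrC ler_wpM2r//.
  by rewrite -[leLHS]mul1r ler_pdivrMr.
have feas := sum_ratio_le hn hopt T0 (fun j => thr_feasible a_ge0 a_served j N).
(* The arithmetic-geometric gap of [Lam k / T k N] and its inverse, weighted by [v k]. The indicator
   makes it vanish when [n k = 0], where [Lam k = 0] annihilates both products. *)
pose t k := Lam k * (v k / T k N) + v k * (T k N / Lam k) - 2 * v k * (0 < n k)%R%:R.
have tE k : 0 < n k -> 0 < v k -> t k = v k * (T k N - Lam k) ^+ 2 / (T k N * Lam k).
  move=> nk vk; rewrite /t nk mulr1; have := Nv k vk; have := Lam_gt0 hopt nk => L0 TT.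
  by field; rewrite !gt_eqF.
have t0 k : 0 <= t k.
  have := hn k; rewrite le_eqVlt => /predU1P[nk|nk].
    rewrite /t -nk ltxx (Lam_eq0 hmu hn hopt huniq (esym nk)) invr0.
    by rewrite !(mul0r, mulr0) subr0 addr0.
  have := v0 k; rewrite le_eqVlt => /predU1P[vk|vk].
    by rewrite /t -vk !(mul0r, mulr0) subr0 addr0.
  by rewrite tE//; apply: divr_ge0; apply: mulr_ge0 => //; exact: sqr_ge0.
(* Add [upper] and [feas]; passing between [n k] and [v k] costs at most [d * (1 + M / Lam k)] per
   route. *)
have tsum : \sum_k t k <= d * K1.
  apply: (@le_trans _ _ (d * #|J|%:R + \sum_k (v k + n k +
      (v k - n k) * (T k N / Lam k) - 2 * v k * (0 < n k)%R%:R))).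
    rewrite /t !sumrB !big_split /=.
    have -> : \sum_k (v k - n k) * (T k N / Lam k) =
       \sum_k v k * (T k N / Lam k) - \sum_k n k * (T k N / Lam k).
      by rewrite -sumrB; apply: eq_bigr => k _; rewrite mulrBl.
    by move: upper feas; lra.
  rewrite /K1 mulrDr lerD2l mulr_sumr; apply: ler_sum => k _; rewrite mulrDr mulr1.
  have h1 : (v k - n k) * (T k N / Lam k) <= d * (M / Lam k).
    apply: (le_trans (ler_norm _)); rewrite normrM.
    rewrite ler_pM//.
    by rewrite ger0_norm ?divr_ge0// ler_wpM2r ?invr_ge0.
  have := vn k; rewrite ler_norml => /andP[h2 h3].
  have := hn k; rewrite le_eqVlt => /predU1P[nk|nk].
    by move: h1 h3; rewrite -nk ltxx mulr0n mulr0; lra.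
  by rewrite nk mulr1; lra.
(* All terms are nonnegative, so [t i] alone obeys the bound; with [v i >= n i / 2] and [T i N <= M]
   it controls the square. *)
have vi : n i / 2 <= v i.
  by have := vn i; rewrite ler_norml => /andP[h2 h3]; lra.
have vi0 : 0 < v i by lra.
have : t i <= d * K1.
  apply: le_trans tsum; rewrite (bigD1 i)//= lerDl; exact: sumr_ge0.
have Ti0 := Nv i vi0.
rewrite tE// ler_pdivrMr ?mulr_gt0// => h.
set X := (T i N - Lam i) ^+ 2 in h *.
have h4 : n i / 2 * X <= v i * X by rewrite ler_wpM2r// sqr_ge0.
have h5 : d * K1 * (T i N * Lam i) <= d * K1 * (M * Lam i).
  by rewrite ler_wpM2l ?mulr_ge0 ?ler_wpM2r// ltW.
rewrite -(ler_pM2l ni).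
have -> : n i * (K1 * M * Lam i * 2 / n i * d) = 2 * (d * K1 * (M * Lam i)).
  by field; rewrite gt_eqF.
by lra.
Qed.

Lemma thr_near_pos i e : 0 < n i -> 0 < e -> exists2 d, 0 < d &
  forall c N, near_ray n d c N -> `|T i N - Lam i| <= e.
Proof.
move=> ni e0; have [K K0 KP] := thr_near_sqr ni.
pose d := Num.min (n i / 2) (e ^+ 2 / (K + 1)).
have e20 : 0 < e ^+ 2 by rewrite exprn_gt0.
have d0 : 0 < d by rewrite lt_min !divr_gt0//; lra.
exists d => // c N H.
rewrite -(@ler_pXn2r _ 2)// ?nnegrE ?(ltW e0)// real_normK ?num_real//.
apply: le_trans (KP d c N d0 _ H) _; first by rewrite ge_min lexx.
apply: (@le_trans _ _ (K * (e ^+ 2 / (K + 1)))).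
  by rewrite ler_wpM2l// ge_min lexx orbT.
rewrite mulrA ler_pdivrMr; last by lra.
by rewrite mulrC ler_wpM2l ?ltW//; lra.
Qed.

Lemma thr_near e : 0 < e -> exists2 d, 0 < d &
  forall c N, near_ray n d c N -> forall i, `|T i N - Lam i| <= e.
Proof.
move=> e0; apply: near_ray_forall => i.
have := hn i; rewrite le_eqVlt => /predU1P[ni|ni]; last exact: thr_near_pos.
have [j rj sat] := saturated_queue hmu hn hopt huniq i.
have aji : 0 < a j i by rewrite /srv rj invr_gt0 hmu.
have Li := Lam_eq0 hmu hn hopt huniq (esym ni).
pose A := \sum_k a j k; have A0 : 0 < A.
  by rewrite /A (bigD1 i)//= ltr_pwDl// sumr_ge0.
pose e' := e * a j i / A.
have e'0 : 0 < e' by rewrite divr_gt0// mulr_gt0.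
have [d d0 dP] : exists2 d, 0 < d & forall c N, near_ray n d c N ->
    forall k, 0 < n k -> `|T k N - Lam k| <= e'.
  apply: near_ray_forall => k; have [nk|nk] := ltP 0 (n k).
    by have [d d0 dP] := thr_near_pos nk e'0; exists d => // c N /dP.
  by exists 1 => // c N _; rewrite ltNge nk.
exists d => // c N /dP H.
have T0 k : 0 <= T k N := thr_ge0 a_ge0 a_served k N.
rewrite Li subr0 ger0_norm// -(ler_pM2l aji).
have := thr_feasible a_ge0 a_served j N; rewrite -{1}sat (bigD1 i)//=.
rewrite [X in _ <= X](bigD1 i)//= Li mulr0 add0r -lerBrDr -sumrB => h.
apply: le_trans h _.
apply: (@le_trans _ _ (\sum_(k | k != i) a j k * e')).
  apply: ler_sum => k _; rewrite -mulrBr ler_wpM2l//.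
  (* If [n k = 0] then [Lam k - T k N = - T k N <= 0], so no estimate for such routes is
     presupposed. *)
  have := hn k; rewrite le_eqVlt => /predU1P[nk|nk].
    by rewrite (Lam_eq0 hmu hn hopt huniq (esym nk)); have := T0 k; lra.
  by have := H k nk; rewrite ler_norml => /andP[]; lra.
apply: (@le_trans _ _ (A * e')).
  by rewrite -mulr_suml ler_wpM2r ?(ltW e'0)// /A [leRHS](bigD1 i)//= lerDr.
by rewrite /e' mulrCA divff ?gt_eqF// mulr1 mulrC.
Qed.

End ThroughputLimit.

(** * Convergence of the means *)

Lemma natr_mul_expr_le (R : realType) (x : R) r : 0 <= x -> x < 1 ->
  r%:R * x ^+ r * (1 - x) <= 1.
Proof.
(* [1 - x ^+ r] is [1 - x] times a sum of [r] powers, each at least [x ^+ r]. *)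
move=> x0 x1; suff : r%:R * x ^+ r * (1 - x) <= 1 - x ^+ r.
  by have := exprn_ge0 r x0; lra.
elim: r => [|r IH]; first by rewrite expr0 mul0r subrr mul0r.
rewrite -natr1 exprS.
have y0 := exprn_ge0 r x0; have y1 : x ^+ r <= 1 by rewrite exprn_ile1// ltW.
have H1 := ler_wpM2l x0 IH.
have H2 : 0 <= (1 - x) * (1 - x * x ^+ r).
  by rewrite mulr_ge0 ?subr_ge0// ?mulr_ile1// ltW.
move: (x ^+ r) H1 H2 y0 y1 => y H1 H2 y0 y1.
lra.
Qed.

(** Split [x ^+ r] into two powers of [Num.sqrt x]: one absorbs the affine factor by
    [natr_mul_expr_le], the other tends to [0]. *)
Lemma cvg_expr_affine (R : realType) (x al be : R) : 0 <= x -> x < 1 ->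
  (fun r : nat => x ^+ r * (al * r%:R + be)) @ \oo --> (0 : R).
Proof.
move=> x0 x1; pose s := Num.sqrt x.
have s0 : 0 <= s := sqrtr_ge0 x.
have s1 : s < 1 by rewrite -(@ltr_pXn2r _ 2)// ?nnegrE// sqr_sqrtr// expr1n.
pose C := `|al| / (1 - s) + `|be|.
have sC r : `|x ^+ r * (al * r%:R + be)| <= s ^+ r * C.
  have -> : x ^+ r = s ^+ r * s ^+ r by rewrite -exprMn -expr2 sqr_sqrtr.
  have sr0 : 0 <= s ^+ r := exprn_ge0 r s0.
  have sr1 : s ^+ r <= 1 by rewrite exprn_ile1// ltW.
  rewrite -mulrA normrM (ger0_norm sr0) ler_wpM2l// normrM (ger0_norm sr0).
  apply: (@le_trans _ _ (s ^+ r * (`|al| * r%:R + `|be|))).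
    rewrite ler_wpM2l// (le_trans (ler_normD _ _))// normrM lerD2r.
    by rewrite (@ger0_norm _ r%:R).
  rewrite /C mulrDr lerD//; last by rewrite ler_piMl.
  rewrite mulrCA ler_wpM2l// mulrC -[leRHS]mul1r ler_pdivlMr ?subr_gt0//.
  exact: natr_mul_expr_le.
apply: norm_cvg0; apply: (@squeeze_cvgr _ _ _ _ (fun=> 0) (fun r => s ^+ r * C)).
- by apply: nearW => r; rewrite normr_ge0 sC.
- exact: cvg_cst.
- rewrite -[X in _ --> X](mul0r C); apply: cvgM; last exact: cvg_cst.
  by apply: cvg_expr; rewrite ger0_norm.
Qed.

Section MeanLimit.
Variables (R : realType) (J I : finType) (route : I -> J -> bool).
Variables (mu : J -> I -> R) (n Lam : I -> R).
Hypothesis hmu : forall j i, route i j -> 0 < mu j i.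
Hypothesis hn : forall i, 0 <= n i.
Hypothesis hopt : is_optimizer route mu n Lam.
Hypothesis huniq : forall L, is_optimizer route mu n L -> L = Lam.

Local Notation a := (srv route mu).
Local Notation T := (thr a).

Let a_ge0 : forall j i, 0 <= a j i := srv_ge0 hmu.
Let a_served : forall i, exists j, 0 < a j i := srv_served hmu hn hopt huniq.
Let L_ge0 := Lam_ge0 hopt.

Local Notation F N j := (\sum_k meanq a N j k).
Local Notation A j := (\sum_k a j k).

Lemma sum_srv_Lam_ge0 j : 0 <= \sum_k a j k * Lam k.
Proof. by apply: sumr_ge0 => k _; rewrite mulr_ge0. Qed.

Lemma fixpoint_ge0 (rho f : R) : 0 <= rho -> rho < 1 -> f = rho * (1 + f) -> 0 <= f.
Proof.
move=> r0 r1 fE; have r1' : 0 < 1 - rho by rewrite subr_gt0.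
rewrite -(pmulr_rge0 _ r1') (_ : (1 - rho) * f = rho)//.
by rewrite mulrBl mul1r [X in X - _]fE; ring.
Qed.

Lemma decr_dist (N : I -> nat) i k : `|(decr i N k)%:R - (N k)%:R| <= 1 :> R.
Proof.
rewrite /decr; case: eqP => _ /=; last by rewrite subn0 subrr normr0.
case: (N k) => [|p]; first by rewrite subrr normr0.
by rewrite subn1 /= -natr1 opprD addrA subrr add0r normrN1.
Qed.

(** Sum [meanq_rec] over the routes and subtract the equation for [f]: the error contracts by
    [\sum_k a j k * T k N], at most [(1 + rho) / 2]. The margin [r%:R] keeps near the ray every
    population met while [r] customers are removed. *)
Lemma sum_meanq_contract (rho f : R) j d e c r N :
  rho = \sum_k a j k * Lam k -> rho < 1 -> f = rho * (1 + f) ->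
  0 <= e -> e * A j <= (1 - rho) / 2 ->
  (forall c N, near_ray n d c N -> forall i, `|T i N - Lam i| <= e) ->
  1 <= d * c%:R -> (forall k, `|(N k)%:R - c%:R * n k| + r%:R <= d * c%:R) ->
  `|F N j - f| <= e * A j * (1 + f) / ((1 - rho) / 2)
     + ((1 + rho) / 2) ^+ r * ((\sum_k N k)%:R + f).
Proof.
move=> rhoE rho1 fE e0 eA near dc.
have rho0 : 0 <= rho by rewrite rhoE sum_srv_Lam_ge0.
have f0 := fixpoint_ge0 rho0 rho1 fE.
have fsum : f = \sum_k a j k * Lam k * (1 + f).
  by rewrite -mulr_suml -rhoE.
have A0 : 0 <= A j by apply: sumr_ge0.
have F0 M : 0 <= F M j by apply: sumr_ge0 => k _; exact: meanq_ge0.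
(* [E] is the fixed point of the error recursion, which sends [x] to
   [(1 + rho) / 2 * x + e * A j * (1 + f)]. *)
set E := _ / _.
have E0 : 0 <= E.
  by apply: divr_ge0; [apply: mulr_ge0; [exact: mulr_ge0|lra]|lra].
elim: r N => [|r IH] N HN.
  rewrite expr0 mul1r.
  have FN := sum_meanq_le a_ge0 a_served N j.
  by rewrite ler_norml; apply/andP; have := F0 N; split; lra.
have NN : near_ray n d c N.
  by split=> // k; have := HN k; have := ler0n R r.+1; lra.
have dT := near c N NN.
have T0 k : 0 <= T k N := thr_ge0 a_ge0 a_served k N.
set S := E + ((1 + rho) / 2) ^+ r * ((\sum_k N k)%:R + f).
have S0 : 0 <= S.
  by rewrite addr_ge0// mulr_ge0 ?addr_ge0// exprn_ge0//; lra.
have FS i : `|F (decr i N) j - f| <= S.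
  apply: le_trans (IH (decr i N) _) _.
    move=> k; have := HN k; rewrite -natr1.
    have := decr_dist N i k.
    have := ler_normD ((decr i N k)%:R - (N k)%:R) ((N k)%:R - c%:R * n k).
    rewrite addrA subrK; lra.
  rewrite lerD2l ler_wpM2l ?exprn_ge0//; first by lra.
  rewrite lerD2r ler_nat; apply: leq_sum => k _; exact: leq_subr.
have step : `|F N j - f| <= \sum_k a j k * T k N * S + e * A j * (1 + f).
  rewrite {1}fsum -sumrB.
  apply: (le_trans (ler_norm_sum _ _ _)).
  rewrite mulr_sumr mulr_suml -big_split /=; apply: ler_sum => k _.
  rewrite meanq_rec//.
  have -> : a j k * T k N * (1 + F (decr k N) j) - a j k * Lam k * (1 + f) =
     a j k * T k N * (F (decr k N) j - f) + a j k * (T k N - Lam k) * (1 + f) by ring.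
  apply: (le_trans (ler_normD _ _)); apply: lerD.
    by rewrite normrM ger0_norm ?mulr_ge0// ler_wpM2l ?mulr_ge0.
  rewrite !normrM (ger0_norm (a_ge0 _ _)) (@ger0_norm _ (1 + f)); last by lra.
  by rewrite ler_wpM2r ?addr_ge0// mulrC ler_wpM2r.
have sumT : \sum_k a j k * T k N <= (1 + rho) / 2.
  have : \sum_k a j k * T k N <= rho + e * A j.
    rewrite rhoE mulr_sumr -big_split /=; apply: ler_sum => k _.
    have := dT k; rewrite ler_norml => /andP[_ h].
    have := ler_wpM2l (a_ge0 j k) h; lra.
  lra.
apply: (le_trans step); rewrite -mulr_suml.
apply: (@le_trans _ _ ((1 + rho) / 2 * S + e * A j * (1 + f))).
  by rewrite lerD2r ler_wpM2r.
rewrite /S exprS le_eqVlt; apply/orP; left; apply/eqP.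
have -> : e * A j * (1 + f) = E * ((1 - rho) / 2) by rewrite /E; field; lra.
by field.
Qed.

Lemma near_ray_eventually (K : R) (N : nat -> I -> nat) d :
  (forall c k, `|(N c k)%:R - c%:R * n k| <= K) -> 0 < d ->
  \forall c \near \oo, near_ray n d c (N c).
Proof.
move=> NK d0; near=> c.
have h : `|K| + 1 <= d * c%:R.
  rewrite mulrC -ler_pdivrMr//; near: c; exact: nbhs_infty_ger.
split=> [|k]; first by have := normr_ge0 K; lra.
by have := NK c k; have := ler_norm K; lra.
Unshelve. all: by end_near. Qed.

Lemma cvg_thr (K : R) (N : nat -> I -> nat) i :
  (forall c k, `|(N c k)%:R - c%:R * n k| <= K) ->
  (fun c => T i (N c)) @ \oo --> Lam i.
Proof.
move=> NK; apply/cvgrPdist_le => e e0.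
have [d d0 dP] := thr_near hmu hn hopt huniq e0.
near=> c; rewrite distrC; apply: (dP c).
near: c; exact: near_ray_eventually NK _.
Unshelve. all: by end_near. Qed.

Lemma cvg_sum_meanq (K rho f : R) (N : nat -> I -> nat) j :
  rho = \sum_k a j k * Lam k -> rho < 1 -> f = rho * (1 + f) ->
  (forall c k, `|(N c k)%:R - c%:R * n k| <= K) ->
  (fun c => F (N c) j) @ \oo --> f.
Proof.
move=> rhoE rho1 fE NK.
have rho0 : 0 <= rho by rewrite rhoE sum_srv_Lam_ge0.
have f0 := fixpoint_ge0 rho0 rho1 fE.
have A0 : 0 <= A j by apply: sumr_ge0.
apply/cvgrPdist_le => eps eps0.
(* The first entry secures the contraction, the second a residual error of at most [eps / 2]; each
   [+ 1] keeps a denominator positive. *)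
pose e := Num.min ((1 - rho) / 2 / (A j + 1))
  (eps / 2 * ((1 - rho) / 2) / (A j * (1 + f) + 1)).
have AF0 : 0 <= A j * (1 + f) by rewrite mulr_ge0//; lra.
have e0 : 0 < e.
  by rewrite lt_min; apply/andP; split; rewrite !(divr_gt0, mulr_gt0)//; lra.
have eA : e * A j <= (1 - rho) / 2.
  apply: (@le_trans _ _ ((1 - rho) / 2 / (A j + 1) * A j)).
    by rewrite ler_wpM2r// ge_min lexx.
  by rewrite mulrAC ler_pdivrMr ?ler_wpM2l//; lra.
have eE : e * A j * (1 + f) / ((1 - rho) / 2) <= eps / 2.
  rewrite ler_pdivrMr; last by lra.
  rewrite -mulrA; apply: (@le_trans _ _
    (eps / 2 * ((1 - rho) / 2) / (A j * (1 + f) + 1) * (A j * (1 + f)))).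
    by rewrite ler_wpM2r// ge_min lexx orbT.
  rewrite mulrAC ler_pdivrMr ?ler_wpM2l ?mulr_ge0//; lra.
have [d d0 dP] := thr_near hmu hn hopt huniq e0.
(* The recursion is run [c %/ q] times. As [q >= 2 / d], this uses at most half of the allowance
   [d * c], while [c < q * (c %/ q).+1] bounds the starting error by an affine function of the
   number of steps. *)
have [q q0 qd] : exists2 q : nat, (0 < q)%N & 2 / d <= q%:R.
  exists (Num.truncn (2 / d)).+1 => //.
  by rewrite ltW// truncnS_gt.
pose S := \sum_k n k; have S0 : 0 <= S by apply: sumr_ge0.
pose al := q%:R * S; pose be := q%:R * S + `|K| * #|I|%:R + f.
have x01 : 0 <= (1 + rho) / 2 /\ (1 + rho) / 2 < 1 by split; lra.
have /cvgrPdist_le/(_ (eps / 2))[] := cvg_expr_affine al be x01.1 x01.2; first by lra.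
move=> r0 _ r0P; near=> c; rewrite distrC.
have [rc cq] : (r0 <= c %/ q)%N /\ (c < q * (c %/ q).+1)%N.
  split; last by rewrite mulnC ltn_ceil.
  by rewrite leq_divRL//; near: c; exact: nbhs_infty_ge.
have rd : (c %/ q)%:R <= d / 2 * c%:R.
  have : (c %/ q)%:R * q%:R <= c%:R :> R by rewrite -natrM ler_nat leq_divM.
  have := ler_wpM2l (ler0n R (c %/ q)) qd => h1 h2.
  have := le_trans h1 h2; rewrite mulrA ler_pdivrMr//; lra.
have h : 2 * `|K| + 1 <= d * c%:R.
  rewrite [d * _]mulrC -ler_pdivrMr//; near: c; exact: nbhs_infty_ger.
have K0 := normr_ge0 K.
apply: le_trans (sum_meanq_contract (c := c) (r := c %/ q)
  rhoE rho1 fE (ltW e0) eA dP _ _) _.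
- by lra.
- by move=> k; have := NK c k; have := ler_norm K; lra.
suff : ((1 + rho) / 2) ^+ (c %/ q) * ((\sum_k N c k)%:R + f) <= eps / 2 by lra.
apply: le_trans (r0P _ rc); rewrite sub0r normrN; apply: le_trans (ler_norm _).
rewrite ler_wpM2l ?exprn_ge0 ?x01.1// /be addrA lerD2r natr_sum.
apply: (@le_trans _ _ (\sum_k (c%:R * n k + `|K|))).
  apply: ler_sum => k _; have := NK c k; have := ler_norm K.
  rewrite ler_norml => ? /andP[]; lra.
have sc : \sum_(k : I) `|K| = `|K| * #|I|%:R by rewrite sumr_const mulr_natr.
rewrite big_split /= -mulr_sumr sc -/S addrA lerD2r /al.
have : c%:R <= q%:R * ((c %/ q)%:R + 1) :> R by rewrite natr1 -natrM ler_nat ltnW.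
move=> /(ler_wpM2r S0); lra.
Unshelve. all: by end_near. Qed.


Lemma cvg_meanq (K rho f : R) (N : nat -> I -> nat) j i :
  rho = \sum_k a j k * Lam k -> rho < 1 -> f = rho * (1 + f) ->
  (forall c k, `|(N c k)%:R - c%:R * n k| <= K) ->
  (fun c => meanq a (N c) j i) @ \oo --> a j i * Lam i * (1 + f).
Proof.
move=> rhoE rho1 fE NK.
have NK' c k : `|(decr i (N c) k)%:R - c%:R * n k| <= K + 1.
  have := ler_normD ((decr i (N c) k)%:R - (N c k)%:R) ((N c k)%:R - c%:R * n k).
  by rewrite addrA subrK; have := NK c k; have := decr_dist (N c) i k; lra.
under eq_fun do rewrite meanq_rec//.
apply: cvgM; first by apply: cvgM; [exact: cvg_cst|exact: (cvg_thr NK)].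
by apply: cvgD; [exact: cvg_cst|exact: (cvg_sum_meanq rhoE rho1 fE NK')].
Qed.

End MeanLimit.

(** * Open network *)

Lemma nneseries_EFin (R : realType) (u : nat -> R) (l : R) :
  series u @ \oo --> l -> (\sum_(0 <= d <oo) (u d)%:E = l%:E)%E.
Proof.
move=> ul; apply/cvg_lim => //.
rewrite (_ : (fun _ => _) = EFin \o series u); last first.
  by apply/funext => k /=; rewrite sumEFin.
by apply: cvg_EFin; [exact: nearW|exact: ul].
Qed.

Lemma cvg_series_natr_expr (R : realType) (x : R) : 0 <= x -> x < 1 ->
  series (fun d => d.+1%:R * x ^+ d) @ \oo --> ((1 - x) ^- 2 : R).
Proof.
move=> x0 x1; have y0 : 1 - x != 0 by rewrite gt_eqF// subr_gt0.
have -> : series (fun d => d.+1%:R * x ^+ d) =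
    (fun k : nat => (1 - x) ^- 2 - x ^+ k * ((1 - x)^-1 * k%:R + (1 - x) ^- 2)).
  apply/funext; elim=> [|k IH].
    by rewrite /series /= big_geq// expr0 mulr0 add0r mul1r subrr.
  rewrite (_ : series _ _ = series (fun d => d.+1%:R * x ^+ d) k + k.+1%:R * x ^+ k).
    by rewrite IH (exprS x k) -natr1; move: k%:R (x ^+ k) => p q; field.
  by rewrite /series /= big_nat_recr.
rewrite -[X in _ --> X]subr0; apply: cvgB; first exact: cvg_cst.
exact: cvg_expr_affine.
Qed.

Section OpenNetwork.
Variables (R : realType) (J I : finType).
Implicit Types (b : J -> I -> R) (m : J -> I -> nat).

(** Emptying queue [j] is encoded in the rates, so sums still range over all states and queues can
    be removed one at a time. *)
Definition zrow (j : J) b : J -> I -> R := fun k i => if k == j then 0 else b k i.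

Lemma wgt_eq0 b m j i : b j i = 0 -> m j i != 0%N -> wgt b m = 0.
Proof.
move=> bji mji; rewrite /wgt (bigD1 j)//= [X in _ / _ * X](bigD1 i)//=.
by rewrite bji expr0n (negbTE mji) mul0r mulr0 mul0r.
Qed.

Lemma qlen_eq0 m j : (qlen m j == 0%N) = [forall i, m j i == 0%N].
Proof. by rewrite sum_nat_eq0. Qed.

Lemma wgt_zrow j b m : wgt (zrow j b) m = if qlen m j == 0%N then wgt b m else 0.
Proof.
rewrite qlen_eq0; case: forallP => [m0|/forallP].
  apply: eq_bigr => k _; congr (_ * _); apply: eq_bigr => i _.
  by rewrite /zrow; case: eqVneq => // ->; rewrite (eqP (m0 i)) !expr0.
by rewrite negb_forall => /existsP[i]; apply: wgt_eq0; rewrite /zrow eqxx.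
Qed.

Lemma esum_addc b j i (X : set (J -> I -> nat)) (k : R) :
  \esum_(m in X) (k * ((m j i)%:R * wgt b m))%:E =
  \esum_(m in addc j i @^-1` X) (k * (b j i * (qlen m j).+1%:R * wgt b m))%:E.
Proof.
transitivity (\esum_(m in X `&` [set m | m j i != 0%N]) (k * ((m j i)%:R * wgt b m))%:E).
  rewrite esum_mkcondr; apply: eq_esum => m _; case: ifPn => //.
  by rewrite notin_setE /= => /negP; rewrite negbK => /eqP ->; rewrite mul0r mulr0.
rewrite (reindex_esum _ _ _ _ (addc_bij j i X)); apply: eq_esum => m _.
by rewrite {1}/addc !eqxx addn1 mulrC [_%:R * _]mulrC wgt_addc mulrC.
Qed.

(** Induction in place of the multinomial theorem: at level [d.+1] write [1] as
    [\sum_i m j i / d.+1] and remove a route-[i] customer by [esum_addc]. The constant [k] is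
    general because each step multiplies it by [b j i]. *)
Lemma esum_level b j (h : R) : (forall j i, 0 <= b j i) ->
    (forall k, 0 <= k -> \esum_(m in setT) (k * wgt (zrow j b) m)%:E = (k * h)%:E) ->
  forall d k, 0 <= k -> \esum_(m in [set m | qlen m j = d]) (k * wgt b m)%:E =
    (k * ((\sum_i b j i) ^+ d * h))%:E.
Proof.
move=> b0 hh; elim=> [|d IH] k k0.
  rewrite expr0 mul1r -hh// esum_mkcond; apply: eq_esum => m _.
  rewrite wgt_zrow; case: ifPn => [/set_mem /= ->|]; first by rewrite eqxx.
  by rewrite notin_setE /= => /eqP/negbTE ->; rewrite mulr0.
transitivity (\esum_(m in [set m | qlen m j = d.+1])
    (\sum_i (k / d.+1%:R * ((m j i)%:R * wgt b m))%:E)%E).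
  apply: eq_esum => m /= md; rewrite sumEFin -mulr_sumr -mulr_suml -natr_sum.
  by rewrite -/(qlen m j) md mulrA divfK// pnatr_eq0.
rewrite esum_sum; last first.
  by move=> m i _ _; rewrite lee_fin !mulr_ge0 ?invr_ge0 ?wgt_ge0.
rewrite (eq_bigr (fun i => (k * b j i * ((\sum_i b j i) ^+ d * h))%:E)).
  by rewrite sumEFin -mulr_suml -mulr_sumr exprS !mulrA.
move=> i _; rewrite esum_addc.
rewrite (_ : _ @^-1` _ = [set m | qlen m j = d]); last first.
  apply/seteqP; split=> m /=; rewrite qlen_addc eqxx addn1; first by case.
  by move=> ->.
rewrite -IH ?mulr_ge0//; apply: eq_esum => m /= ->; congr _%:E.
have : d.+1%:R != 0 :> R by rewrite pnatr_eq0.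
by move: d.+1%:R => p p0; field.
Qed.

Lemma esum_qlen b j (h : R) (phi : nat -> R) : (forall j i, 0 <= b j i) ->
    (forall d, 0 <= phi d) ->
    (forall k, 0 <= k -> \esum_(m in setT) (k * wgt (zrow j b) m)%:E = (k * h)%:E) ->
  (\esum_(m in setT) (phi (qlen m j) * wgt b m)%:E =
  \sum_(0 <= d <oo) (phi d * ((\sum_i b j i) ^+ d * h))%:E)%E.
Proof.
move=> b0 phi0 hh.
rewrite (_ : setT = \bigcup_d [set m | qlen m j = d]); last first.
  by apply/seteqP; split=> // m _; exists (qlen m j).
rewrite nneseries_sum_bigcup; last 2 first.
- by move=> d d' _ _ [m [/= -> ->]].
- by move=> m; rewrite lee_fin mulr_ge0// wgt_ge0.
apply: eq_eseriesr => d _; rewrite -esum_level//.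
by apply: eq_esum => m /= ->.
Qed.

Lemma esum_wgt_step b j (h : R) : (forall j i, 0 <= b j i) ->
    \sum_i b j i < 1 ->
    (forall k, 0 <= k -> \esum_(m in setT) (k * wgt (zrow j b) m)%:E = (k * h)%:E) ->
  forall k, 0 <= k ->
    \esum_(m in setT) (k * wgt b m)%:E = (k * ((1 - \sum_i b j i)^-1 * h))%:E.
Proof.
move=> b0 b1 hh k k0; rewrite (esum_qlen (phi := fun=> k) b0 _ hh)//.
apply: nneseries_EFin.
rewrite (_ : (fun _ => _) = geometric (k * h) (\sum_i b j i)); last first.
  by apply/funext => d /=; rewrite mulrCA mulrC -mulrA.
rewrite [X in _ --> X](_ : _ = (k * h) / (1 - \sum_i b j i)).
  by apply: cvg_geometric_series; rewrite ger0_norm// sumr_ge0.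
by rewrite mulrCA mulrC -mulrA.
Qed.

Definition rows (s : seq J) b : J -> I -> R := fun j i => if j \in s then b j i else 0.

Lemma zrow_rows j s b : uniq s -> zrow j (rows s b) = rows (rem j s) b.
Proof.
move=> us; apply/funext => k; apply/funext => i; rewrite /zrow /rows mem_rem_uniq//.
by rewrite inE; case: eqVneq.
Qed.

(** Each queue peeled off contributes a geometric series; with none left only the empty state has
    nonzero weight. *)
Lemma esum_wgt_rows s b : uniq s -> (forall j i, 0 <= b j i) ->
    (forall j, j \in s -> \sum_i b j i < 1) ->
  forall k, 0 <= k -> \esum_(m in setT) (k * wgt (rows s b) m)%:E =
    (k * \prod_(j <- s) (1 - \sum_i b j i)^-1)%:E.
Proof.
move=> + b0; elim: s => [|j s IH] /= => [_ _|/andP[js us] b1] k k0.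
  rewrite big_nil mulr1; pose z : J -> I -> nat := fun _ _ => 0%N.
  rewrite -[RHS](_ : \esum_(m in [set z]) (k * wgt (rows [::] b) m)%:E = _).
    rewrite [RHS]esum_mkcond; apply: eq_esum => m _; case: ifPn => //.
    rewrite notin_setE /= => mz; rewrite (_ : wgt _ _ = 0) ?mulr0//.
    apply: contrapT => w0; apply: mz; apply/funext => j; apply/funext => i.
    by apply: contrapT => /eqP mji; apply: w0; exact: wgt_eq0 mji.
  have wz : wgt (rows [::] b) z = 1.
    rewrite /wgt big1// => j _; rewrite /qlen [X in X`!]big1//.
    by rewrite !big1 ?divr1 ?mulr1.
  by rewrite esum_set1 wz mulr1.
have uJ : uniq (j :: s) by rewrite /= js.
have rE : \sum_i rows (j :: s) b j i = \sum_i b j i.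
  by apply: eq_bigr => i _; rewrite /rows mem_head.
rewrite big_cons -rE; apply: esum_wgt_step => //.
- by move=> k' i; rewrite /rows; case: ifP.
- by rewrite rE b1 ?mem_head.
- by move=> k' k'0; rewrite zrow_rows//= eqxx IH// => l ls; rewrite b1// inE ls orbT.
Qed.

(** Removing one customer leaves the series of [d.+1 * rho ^+ d] at queue [j], with sum
    [(1 - rho) ^- 2]: one power belongs to the total mass, the other to the mean. *)
Lemma esum_mean_rows s b j i : uniq s -> (forall j i, 0 <= b j i) ->
    (forall j, j \in s -> \sum_i b j i < 1) -> j \in s -> forall k, 0 <= k ->
  \esum_(m in [set: J -> I -> nat]) (k * ((m j i)%:R * wgt (rows s b) m))%:E =
    (k * (b j i / (1 - \sum_i b j i) * \prod_(j <- s) (1 - \sum_i b j i)^-1))%:E.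
Proof.
move=> us b0 b1 js k k0; rewrite esum_addc preimage_setT.
have rE l : rows s b j l = b j l by rewrite /rows js.
have sE : \sum_l rows s b j l = \sum_l b j l by apply: eq_bigr.
have r0 j' l : 0 <= rows s b j' l by rewrite /rows; case: ifP.
rewrite (eq_esum (b := fun m =>
    ((fun d => k * b j i * d.+1%:R) (qlen m j) * wgt (rows s b) m)%:E)).
  rewrite (esum_qlen (b := rows s b) (j := j) (phi := fun d => k * b j i * d.+1%:R)
    (h := \prod_(j <- rem j s) (1 - \sum_i b j i)^-1))//; last 2 first.
  - by move=> d; rewrite !mulr_ge0.
  - move=> k' k'0; rewrite zrow_rows// esum_wgt_rows ?rem_uniq//.
    by move=> l /mem_rem/b1.
  rewrite sE [in RHS](big_rem j)//=.
  set P := \prod_(l <- rem j s) (1 - \sum_i b l i)^-1.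
  set rho := \sum_l b j l.
  have rho0 : 0 <= rho by apply: sumr_ge0.
  have rho1 : rho < 1 by rewrite b1.
  apply: nneseries_EFin.
  rewrite (_ : series _ = fun d => k * b j i * P * series (fun d => d.+1%:R * rho ^+ d) d).
    rewrite [X in _ --> X](_ : _ = k * b j i * P * (1 - rho) ^- 2).
      by apply: cvgM; [exact: cvg_cst|exact: cvg_series_natr_expr].
    by field; rewrite gt_eqF// subr_gt0.
  by apply/funext => d; rewrite /series /= mulr_sumr; apply: eq_bigr => l _; ring.
by move=> m _; rewrite rE !mulrA.
Qed.

End OpenNetwork.

(** * Expectations in closed form *)

Section Translation.
Variables (R : realType) (J I : finType) (route : I -> J -> bool).
Variable mu : J -> I -> R.
Implicit Types (m : J -> I -> nat) (N : I -> nat).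

Local Notation a := (srv route mu).

Lemma mq_qlen m j : (forall i, ~~ route i j -> m j i = 0%N) -> mq route m j = qlen m j.
Proof.
move=> m0; rewrite /mq big_mkcond; apply: eq_bigr => i _.
by case: ifPn => // /m0.
Qed.

Lemma prod_fact_route m j : (forall i, ~~ route i j -> m j i = 0%N) ->
  \prod_(i | route i j) (m j i)`!%:R = \prod_i (m j i)`!%:R :> R.
Proof.
move=> m0; rewrite big_mkcond; apply: eq_bigr => i _.
by case: ifPn => // /m0 ->.
Qed.

Lemma prod_expr_route m j (f g : I -> R) : (forall i, ~~ route i j -> m j i = 0%N) ->
    (forall i, route i j -> f i = g i) ->
  \prod_(i | route i j) f i ^+ m j i = \prod_i g i ^+ m j i.
Proof.
move=> m0 fg; rewrite big_mkcond; apply: eq_bigr => i _.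
by case: ifPn => [/fg ->//|/m0 ->]; rewrite expr0.
Qed.

Lemma weight_wgt m : (forall j i, ~~ route i j -> m j i = 0%N) ->
  weight route mu m = wgt a m.
Proof.
move=> m0; apply: eq_bigr => j _; rewrite mq_qlen ?(prod_fact_route (m0 j))//; last exact: m0.
congr (_ * _); under eq_bigr do rewrite -exprVn.
by apply: prod_expr_route (m0 j) _ => i rij; rewrite /srv rij.
Qed.

Lemma clen_route m i : (forall j i, ~~ route i j -> m j i = 0%N) ->
  (\sum_(j | route i j) m j i)%N = clen m i.
Proof.
move=> m0; rewrite big_mkcond; apply: eq_bigr => j _.
by case: ifPn => // /m0.
Qed.

(** States with a customer off its route have weight [0] under [a], so [pop N] may include them; on
    the others [to_fun] is a bijection, as no entry exceeds [sumN N]. *)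
Lemma sum_enc_state N (h : (J -> I -> nat) -> R) :
  \sum_(m : enc_state J N | in_S route m) h (to_fun m) * weight route mu (to_fun m)
  = psum a N h.
Proof.
pose S := pop N `&` [set m | forall j i, ~~ route i j -> m j i = 0%N].
rewrite psumE -(@fsbig_widen _ _ _ _ S); last 2 first.
- exact: subIsetl.
- move=> m [mN /= /not_andP[//|/existsNP[j /existsNP[i /not_implyP[rij /eqP mji]]]]].
  by rewrite (@wgt_eq0 _ _ _ _ _ j i) ?mul0r// /srv (negbTE rij).
have bij : set_bij [set` in_S (N := N) route] S (@to_fun J I N).
  have inSP (m : enc_state J N) : in_S route m <-> S (to_fun m).
    rewrite /in_S; split.
      move=> /andP[/forallP h1 /forallP h2].
      have off j i : ~~ route i j -> to_fun m j i = 0%N.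
        by move=> /negbTE rij; have /forallP/(_ i) := h1 j; rewrite rij => /eqP.
      by split=> // i; rewrite -clen_route//; exact/eqP.
    move=> [mN off]; apply/andP; split; apply/forallP.
      move=> j; apply/forallP => i; case: (boolP (route i j)) => //= /off ->//.
    by move=> i; rewrite clen_route//; apply/eqP; exact: mN.
  split.
  - by move=> m /inSP.
  - move=> m m' _ _ mm'; apply/ffunP => j; apply/ffunP => i; apply: val_inj.
    by have := congr1 (fun f => f j i) mm'.
  - move=> m mS; pose e : enc_state J N := [ffun j => [ffun i => inord (m j i)]].
    have em : to_fun e = m.
      apply/funext => j; apply/funext => i; rewrite /to_fun !ffunE inordK// ltnS.
      rewrite (leq_trans (le_pop j i mS.1))// /sumN (bigD1 i)//= leq_addr//.
    by exists e => //; apply/inSP; rewrite em.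
rewrite (reindex_fsbig _ _ _ _ bij) [LHS]bigfs ?index_enum_uniq//; last first.
  by move=> m _ /negP[]; exact: mem_index_enum.
apply: eq_fsbigr => m /set_mem /= mS; rewrite mulrC weight_wgt//.
have [f _ _] := bij; exact: (f m mS).2.
Qed.

Lemma EM_net_meanq N j i : EM_net route mu N j i = meanq a N j i.
Proof.
rewrite /EM_net /meanq -sum_enc_state; congr (_ / _).
by rewrite /pf -sum_enc_state; apply: eq_bigr => m _; rewrite mul1r.
Qed.

Lemma EM_limE (L : I -> R) j i : (forall j i, route i j -> 0 < mu j i) ->
    (forall i, 0 <= L i) -> nonbottleneck route mu L j ->
  EM_lim route mu L j i = (a j i * L i / (1 - \sum_k a j k * L k))%:E.
Proof.
move=> hmu L0 nbj; pose b j i := a j i * L i.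
have b0 k l : 0 <= b k l by rewrite mulr_ge0// srv_ge0.
pose s := enum (nonbottleneck route mu L).
have sP k : (k \in s) = nonbottleneck route mu L k by rewrite mem_enum.
have nbE k : nonbottleneck route mu L k = (\sum_l b k l < 1).
  by rewrite /nonbottleneck sum_srv.
pose C := \prod_(k <- s) (1 - \sum_l b k l).
have s1 k : k \in s -> \sum_l b k l < 1 by rewrite sP nbE.
have C0 : 0 < C.
  by rewrite /C big_seq; apply: prodr_gt0 => k /s1; rewrite subr_gt0.
(* The limiting law is a product-form weight with rates [b] cut down to the non-bottleneck queues;
   [C] is the inverse of its total mass and cancels at the end. *)
have pi0E m : S0 route mu L m -> pi0 route mu L m = C * wgt (rows s b) m.
  move=> mS.
  have -> : wgt (rows s b) m = \prod_(k | nonbottleneck route mu L k)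
      ((qlen m k)`!%:R / \prod_l (m k l)`!%:R * \prod_l b k l ^+ m k l).
    rewrite [RHS]big_mkcond; apply: eq_bigr => k _; case: ifPn => nbk.
      by congr (_ * _); apply: eq_bigr => l _; rewrite /rows sP nbk.
    have m0 l : m k l = 0%N by apply: mS; rewrite (negbTE nbk).
    rewrite /qlen big1// !big1 ?divr1 ?mulr1// => l _; rewrite m0//.
  rewrite /C big_enum /= -big_split /=; apply: eq_bigr => k nbk.
  have m0 l : ~~ route l k -> m k l = 0%N.
    by move=> /negbTE rlk; apply: mS; rewrite rlk andbF.
  rewrite mq_qlen// (prod_fact_route m0) (prod_expr_route (g := b k) m0) ?mulrA//.
    by rewrite sum_srv.
  by move=> l rlk; rewrite /b /srv rlk mulrC.
rewrite /EM_lim esum_mkcond.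
rewrite (eq_esum (b := fun m => (C * ((m j i)%:R * wgt (rows s b) m))%:E)).
  rewrite esum_mean_rows ?enum_uniq ?sP ?(ltW C0)//; congr _%:E.
  by rewrite prodfV mulrCA divff ?mulr1// gt_eqF.
move=> m _; case: ifPn => [/set_mem mS|].
  by rewrite pi0E// mulrCA.
rewrite notin_setE => /existsNP[k /existsNP[l /not_implyP[nb /eqP mkl]]].
rewrite (@wgt_eq0 _ _ _ _ _ k l) ?mulr0// /rows sP.
move: nb; rewrite negb_and; case: ifP => //= _.
by rewrite /b /srv => /negbTE ->; rewrite mul0r.
Qed.

End Translation.

Theorem theorem2 (R : realType) (J I : finType) (route : I -> J -> bool)
  (mu : J -> I -> R) (hmu : forall j i, route i j -> 0 < mu j i)
  (n : I -> R) (hn : forall i, 0 <= n i)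
  (Lam : I -> R) (hopt : is_optimizer route mu n Lam)
  (huniq : forall L, is_optimizer route mu n L -> L = Lam)
  (u : nat -> I -> R) (hu : exists K : R, forall c i, `|u c i| <= K)
  (N : nat -> I -> nat)
  (hN : forall c i, (N c i)%:R = c%:R * n i + u c i)
  (j : J) (i : I) (hj : nonbottleneck route mu Lam j) (hji : route i j) :
  (fun c : nat => (EM_net route mu (N c) j i)%:E) @ \oo -->
    EM_lim route mu Lam j i.
Proof.
have [K uK] := hu.
rewrite (EM_limE i hmu (Lam_ge0 hopt) hj).
apply: cvg_EFin; first exact: nearW.
rewrite (_ : fine \o _ = fun c => meanq (srv route mu) (N c) j i); last first.
  by apply/funext => c; rewrite /= EM_net_meanq.
move: (hj); rewrite /nonbottleneck sum_srv; set rho := (X in X < 1) => rho1.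
have rho1' : 1 - rho != 0 by rewrite gt_eqF// subr_gt0.
(* The fixed point is the limiting mean length of queue [j]; adding [1] to it gives the factor
   [(1 - rho)^-1] of [EM_limE]. *)
have fE : rho / (1 - rho) = rho * (1 + rho / (1 - rho)) by field.
have NK c k : `|(N c k)%:R - c%:R * n k| <= K by rewrite hN addrAC subrr add0r.
have -> : srv route mu j i * Lam i / (1 - rho) =
    srv route mu j i * Lam i * (1 + rho / (1 - rho)) by field.
exact: (cvg_meanq hmu hn hopt huniq (i := i) erefl rho1 fE NK).
Qed.
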